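(* Let $q_0\in(0,\infty)$ and let $X=X(\mathbb R^n\times\mathbb R^m)$ be a product ball quasi-Banach function space such that $X^{1/q_0}$ is a product ball Banach function space and the strong Hardy--Littlewood maximal operator $\mathcal M_s$ is bounded on $(X^{1/q_0})'$. Let $T$ be an operator (not assumed linear or sublinear) and let $\mathcal F$ be a family of ordered pairs $(Tf,f)$ of non-negative measurable functions on $\mathbb R^n\times\mathbb R^m$. Assume that $$\int_{\mathbb R^n\times\mathbb R^m}Tf(x,y)^{q_0}w_0(x,y)\,dxdy\le C_0\int_{\mathbb R^n\times\mathbb R^m}f(x,y)^{q_0}w_0(x,y)\,dxdy,\qquad(Tf,f)\in\mathcal F,$$ holds for every weight $w_0\in\{\mathcal R_sh:h\in(X^{1/q_0})'\}$. Then for any $(Tf,f)\in\mathcal F$ with $f\in X$, $$\|Tf\|_{X}\le C\|f\|_{X}.$$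
   Context: Ball (quasi-)Banach function spaces: a product ball quasi-Banach function space is a quasi-Banach space $X$ of measurable functions on $\mathbb R^n\times\mathbb R^m$ such that (i) $\|f\|_X=0$ implies $f=0$ a.e.; (ii) $|g|\le|f|$ a.e. implies $\|g\|_X\le\|f\|_X$; (iii) $0\le f_i\uparrow f$ a.e. implies $\|f_i\|_X\uparrow\|f\|_X$; (iv) $\chi_B\in X$ for every ball $B=\{u\in\mathbb R^n\times\mathbb R^m:|z-u|<r\}$. It is a product ball Banach function space if in addition $\|\cdot\|_X$ satisfies the triangle inequality and for every ball $B$ there is $C_{(B)}>0$ with $\int_B|f|\le C_{(B)}\|f\|_X$ for all $f\in X$. For $p>0$, $X^p=\{f:|f|^p\in X\}$ with $\|f\|_{X^p}=\||f|^p\|_X^{1/p}$. The associate space $X'$ consists of all measurable $f$ with $\|f\|_{X'}=\sup\{\|fg\|_{L^1}:\|g\|_X\le1\}<\infty$. Strong maximal operator: $\mathcal M_sf(z)=\sup_{R\ni z}\frac1{|R|}\int_R|f|$, the supremum over all rectangles $R=I\times J$ with $I\subset\mathbb R^n$, $J\subset\mathbb R^m$ cubes. Rubio de Francia iteration: with $Y=X^{1/q_0}$ and $\|\mathcal M_s\|_{Y'\to Y'}$ the operator norm of $\mathcal M_s$ on $Y'$, $$\mathcal R_sh=\sum_{k=0}^\infty\frac{\mathcal M_s^kh}{2^k\|\mathcal M_s\|_{Y'\to Y'}^k},$$ where $\mathcal M_s^k$ is the $k$-fold iterate of $\mathcal M_s$ and $\mathcal M_s^0h=|h|$. *)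

(* Defs.v *)
From HB Require Import structures.
From mathcomp Require Import all_boot all_order all_algebra.
From mathcomp Require Import all_classical all_reals all_analysis.
From mathcomp Require Import measurable_realfun.

Set Implicit Arguments.
Unset Strict Implicit.
Unset Printing Implicit Defensive.

Import Order.TTheory GRing.Theory Num.Theory.
Import numFieldNormedType.Exports.

Local Open Scope classical_set_scope.
Local Open Scope ring_scope.

Lemma product_measure_sigma_finite d1 d2 (T1 : measurableType d1)
    (T2 : measurableType d2) (R : realType)
    (m1 : {sigma_finite_measure set T1 -> \bar R})
    (m2 : {sigma_finite_measure set T2 -> \bar R}) :
  sigma_finite [set: T1 * T2] (m1 \x m2)%E.
Proof.
have /sigma_finiteP[F [TF ndF Foo]] := sigma_finiteT m1.
have /sigma_finiteP[G [TG ndG Goo]] := sigma_finiteT m2.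
exists (fun n => F n `*` G n).
  rewrite -setXTT TF TG predeqE => -[x y]; split.
    move=> [/= [n _ Fnx] [k _ Gky]]; exists (maxn n k) => //; split.
    - by move: x Fnx; exact/subsetPset/ndF/leq_maxl.
    - by move: y Gky; exact/subsetPset/ndG/leq_maxr.
  by move=> [n _ []/= ? ?]; split; exists n.
move=> k; have [? ?] := Foo k; have [? ?] := Goo k.
split; first exact: measurableX.
by rewrite product_measure1E// lte_mul_pinfty// ge0_fin_numE.
Qed.

Section tuple_measure.
Context (R : realType) (d : measure_display) (T : measurableType d).
Variable mu : {sigma_finite_measure set T -> \bar R}.
Local Open Scope ereal_scope.

Definition cons_tuple n (p : T * n.-tuple T) : n.+1.-tuple T :=
  [tuple of p.1 :: p.2].

Definition uncons_tuple n (t : n.+1.-tuple T) : T * n.-tuple T :=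
  (thead t, [tuple of behead t]).

Lemma cons_tupleK n : cancel (@cons_tuple n) (@uncons_tuple n).
Proof.
by move=> [x t]; rewrite /uncons_tuple; congr pair; exact: val_inj.
Qed.

Lemma measurable_cons_tuple n : measurable_fun [set: _] (@cons_tuple n).
Proof. exact: measurable_cons. Qed.

Lemma measurable_uncons_tuple n : measurable_fun [set: _] (@uncons_tuple n).
Proof.
by apply/measurable_fun_pair; [exact: measurable_tnth|exact: measurable_behead].
Qed.

Section step.
Context (n : nat) (nu : {sigma_finite_measure set (n.-tuple T) -> \bar R}).

Definition tuple_measure_step : set (n.+1.-tuple T) -> \bar R :=
  pushforward (mu \x nu) (@cons_tuple n).

Let step0 : tuple_measure_step set0 = 0.
Proof. by rewrite /tuple_measure_step /pushforward preimage_set0 measure0. Qed.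

Let step_ge0 A : 0 <= tuple_measure_step A.
Proof. by rewrite /tuple_measure_step /pushforward measure_ge0. Qed.

Let step_sigma_additive : semi_sigma_additive tuple_measure_step.
Proof.
exact: (@measure_semi_sigma_additive _ _ _
  (pushforward (mu \x nu) (mfun_Sub (mem_set (@measurable_cons_tuple n))))).
Qed.

HB.instance Definition _ := isMeasure.Build _ _ _ tuple_measure_step
  step0 step_ge0 step_sigma_additive.

Let step_sigma_finite : sigma_finite setT tuple_measure_step.
Proof.
have [F FT Ffin] := product_measure_sigma_finite mu nu.
exists (fun k => @uncons_tuple n @^-1` F k).
  by rewrite -preimage_bigcup -FT preimage_setT.
move=> k; have [mF Foo] := Ffin k; split.
  by rewrite -[X in measurable X]setTI; exact: measurable_uncons_tuple.
rewrite /tuple_measure_step /pushforward -comp_preimage.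
rewrite (_ : @uncons_tuple n \o @cons_tuple n = id)//.
by apply/funext => p /=; exact: cons_tupleK.
Qed.

HB.instance Definition _ := Measure_isSigmaFinite.Build _ _ _
  tuple_measure_step step_sigma_finite.

End step.

Fixpoint tuple_measure n : {sigma_finite_measure set (n.-tuple T) -> \bar R} :=
  match n with
  | 0 => \d_[tuple]
  | k.+1 => tuple_measure_step (tuple_measure k)
  end.

End tuple_measure.

Section product_space.
Context (R : realType) (n m : nat).
Local Open Scope ereal_scope.

Local Notation lebesgue := (@lebesgue_measure R).
Local Notation borel_lebesgue :=
  (tuple_measure lebesgue n \x tuple_measure lebesgue m).

(* R^n x R^m; its measurable sets are the Lebesgue measurable ones, i.e., the
   completion of the product Borel sigma-algebra *)
Definition Rnm_display : measure_display :=
  caratheodory_display (borel_lebesgue^*)%mu.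
Definition Rnm : measurableType Rnm_display :=
  caratheodory_type (borel_lebesgue^*)%mu.

Definition lebesgue_Rnm : set Rnm -> \bar R :=
  @completed_measure_extension _ _ _ borel_lebesgue.

HB.instance Definition _ := Measure.on lebesgue_Rnm.

End product_space.
Arguments lebesgue_Rnm {R n m}.

Section geometry.
Context (R : realType).

(* closed cube of R^k with edges of length l parallel to the axes *)
Definition cube k (a : k.-tuple R) (l : R) : set (k.-tuple R) :=
  [set x | forall i, tnth a i <= tnth x i <= tnth a i + l].

Context (n m : nat).

Definition rectangle (A : set (Rnm R n m)) : Prop :=
  exists (a : n.-tuple R) (l : R) (b : m.-tuple R) (l' : R),
    [/\ 0 < l, 0 < l' & A = cube a l `*` cube b l'].

Definition euclidean_dist (z u : Rnm R n m) : R :=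
  Num.sqrt (\sum_(i < n) (tnth z.1 i - tnth u.1 i) ^+ 2 +
            \sum_(j < m) (tnth z.2 j - tnth u.2 j) ^+ 2).

Definition eball (z : Rnm R n m) (r : R) : set (Rnm R n m) :=
  [set u | euclidean_dist z u < r].

End geometry.

Lemma measurable_cube (R : realType) k (a : k.-tuple R) (l : R) :
  measurable (cube a l : set (k.-tuple (measurableTypeR R))).
Proof.
rewrite (_ : cube a l = \bigcap_(i in [set: 'I_k])
    ((@tnth k (measurableTypeR R) ^~ i) @^-1` `[tnth a i, tnth a i + l]%classic)).
  apply: fin_bigcap_measurable => // i _; rewrite -[X in measurable X]setTI.
  by apply: measurable_tnth => //; exact: measurable_itv.
apply/seteqP; split => x /= h i; first by move=> _ /=; rewrite in_itv/= h.
by have := h i I; rewrite /= in_itv/=.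
Qed.

Lemma tuple_measure_cube (R : realType) k (a : k.-tuple R) (l : R) : 0 <= l ->
  tuple_measure (@lebesgue_measure R) k (cube a l) = (l ^+ k)%:E.
Proof.
move=> l0; elim: k a => [|k ih] a.
  by rewrite /= diracE mem_set ?expr0//; case.
case/tupleP: a => x a.
rewrite /= /tuple_measure_step /pushforward.
set A := (X in (_ \x _)%E X).
have -> : A = `[x, x + l]%classic `*` cube a l.
  apply/seteqP; split => -[y t] /=.
    move=> h; split => /=; first by have := h ord0; rewrite !tnth0 in_itv.
    by move=> i; have := h (lift ord0 i); rewrite !tnthS.
  rewrite in_itv/= => -[h1 h2] i; case: (unliftP ord0 i) => [j|] ->.
    by rewrite !tnthS; exact: h2.
  by rewrite !tnth0.
rewrite product_measure1E//=; last exact: measurable_cube.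
rewrite ih lebesgue_measure_itv/= lte_fin ltrDl exprS -EFinD addrAC subrr add0r.
by case: ltgtP l0 => // <- _; rewrite mul0r mul0e.
Qed.

Lemma lebesgue_rectangle (R : realType) n m (a : n.-tuple R) (l : R)
    (b : m.-tuple R) (l' : R) : 0 <= l -> 0 <= l' ->
  @lebesgue_Rnm R n m (cube a l `*` cube b l') = (l ^+ n * l' ^+ m)%:E.
Proof.
move=> l0 l'0; rewrite /lebesgue_Rnm /completed_measure_extension.
have mcube : measurable (cube a l `*` cube b l' :
    set (n.-tuple (measurableTypeR R) * m.-tuple (measurableTypeR R))).
  by apply: measurableX; exact: measurable_cube.
rewrite measurable_mu_extE//= product_measure1E;
  [|exact: measurable_cube|exact: measurable_cube].
by rewrite EFinM -(tuple_measure_cube a l0) -(tuple_measure_cube b l'0).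
Qed.

Section function_spaces.
Context (R : realType) (n m : nat).
Local Open Scope ereal_scope.

Local Notation E := (Rnm R n m).
Local Notation mu := (@lebesgue_Rnm R n m).
Local Notation fct := (E -> \bar R).
Implicit Types (N : fct -> \bar R) (f g h : fct).

Definition mfunction f : Prop := measurable_fun [set: E] f.

(* A function space is represented by its (quasi-)norm N, which is defined on
   all measurable functions and takes the value +oo outside the space. *)
Definition carrier N : set fct := [set f | mfunction f /\ N f < +oo].

Record quasi_norm N : Prop := {
  quasi_norm_ge0 : forall f, mfunction f -> 0 <= N f ;
  quasi_normZ : forall (c : R) f, mfunction f ->
    N (fun z => c%:E * f z) = `|c|%:E * N f ;
  quasi_normD : exists2 K : R, (1 <= K)%R &
    forall f g, mfunction f -> mfunction g -> N (f \+ g) <= K%:E * (N f + N g) }.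

Definition complete_norm N : Prop :=
  forall u : nat -> fct, (forall k, carrier N (u k)) ->
    (forall e : R, (0 < e)%R -> exists k0, forall i j, (k0 <= i)%N -> (k0 <= j)%N ->
       N (u i \- u j) < e%:E) ->
    exists2 f, carrier N f & N (u k \- f) @[k --> \oo] --> 0.

(* The definiteness of the quasi-norm is pbqb_eq0. *)
Record product_ball_quasi_banach N : Prop := {
  pbqb_quasi_norm : quasi_norm N ;
  pbqb_complete : complete_norm N ;
  pbqb_eq0 : forall f, mfunction f -> N f = 0 -> \forall z \ae mu, f z = 0 ;
  pbqb_le : forall f g, mfunction f -> mfunction g ->
    (\forall z \ae mu, `|g z| <= `|f z|) -> N g <= N f ;
  pbqb_fatou : forall (u : nat -> fct) f, (forall k, mfunction (u k)) -> mfunction f ->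
    (\forall z \ae mu, (forall k, 0 <= u k z <= u k.+1 z) /\
                         u k z @[k --> \oo] --> f z) ->
    nondecreasing_seq (fun k => N (u k)) /\ N (u k) @[k --> \oo] --> N f ;
  pbqb_ball : forall (z : E) (r : R), (0 < r)%R ->
    carrier N (fun u => (\1_(eball z r) u)%:E) }.

Record product_ball_banach N : Prop := {
  pbb_quasi_banach : product_ball_quasi_banach N ;
  pbb_triangle : forall f g, mfunction f -> mfunction g -> N (f \+ g) <= N f + N g ;
  pbb_integral : forall (z : E) (r : R), (0 < r)%R ->
    exists2 C : R, (0 < C)%R &
      forall f, carrier N f -> \int[mu]_(u in eball z r) `|f u| <= C%:E * N f }.

(* the norm of X^p *)
Definition power_norm N (p : R) f : \bar R := N (fun z => `|f z| `^ p) `^ p^-1.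

(* the norm of X' *)
Definition associate_norm N f : \bar R :=
  ereal_sup [set \int[mu]_z `|f z * g z| | g in [set g | mfunction g /\ N g <= 1]].

Definition strong_maximal f (z : E) : \bar R :=
  ereal_sup [set (mu A)^-1 * \int[mu]_(u in A) `|f u|
            | A in [set A | rectangle A /\ A z]].

Definition bounded_operator N (A : fct -> fct) : Prop :=
  exists C : R, forall f, carrier N f -> carrier N (A f) /\ N (A f) <= C%:E * N f.

Definition operator_norm N (A : fct -> fct) : \bar R :=
  ereal_sup [set N (A f) | f in [set f | mfunction f /\ N f <= 1]].

(* R_s, where N is the norm of Y'; the operator norm is finite as soon as the
   strong maximal operator is bounded on Y' *)
Definition rubio_de_francia N h (z : E) : \bar R :=
  let M := fine (operator_norm N strong_maximal) in
  \sum_(0 <= k <oo) (2 ^+ k * M ^+ k)^-1%:E * iter k strong_maximal (abse \o h) z.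

End function_spaces.

(* Main.v *)
Require Import Defs.
From mathcomp Require Import all_boot all_order all_algebra.
From mathcomp Require Import all_classical all_reals all_analysis.
From mathcomp Require Import measurable_realfun.
From mathcomp Require Import ring lra.

(** The hypothesis controls integrals of [g `^ q0] against the weights produced
    by the Rubio de Francia iteration, and the conclusion bounds a norm of
    [g `^ q0]; the two are linked by duality in Y = X^(1/q0), since
    X g `^ q0 = ||g `^ q0||_Y ([power_norm_poweR]).

    Let N be the norm of Y and N' that of its associate space. Given h >= 0 with
    N' h finite, the iteration R_s h majorizes h ([abs_le_rubio]) and has
    N' (R_s h) <= 2 N' h ([rubio_bound]): its k-th term has norm at most
    2^-k N' h by definition of the operator norm, and N' is countably
    subadditive. Therefore, with G = g `^ q0 and F = f `^ q0,
    int G h <= int G (R_s h) <= C int F (R_s h) <= 2 C N(F) N'(h),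
    the last step by Hölder's inequality ([dual_norm_holder]).

    It remains to recover N(G) from these integrals, which is the Lorentz-
    Luxemburg theorem Y'' = Y ([lorentz_luxemburg]). It is a separation
    statement, and a projection in L^2 is enough to prove it: by the Fatou
    property G can be taken bounded and supported in a ball, hence square
    integrable. If p is the point nearest to G among the functions between 0 and
    G of norm at most A ([exists_nearest_point]), then h = G - p is a functional
    whose maximum over the ball of radius A is attained at p
    ([nearest_point_variational]), so A N'(h) <= int p h. When int G h <= A N'(h),
    as is the case with A = 2 C N(F), it follows that int (G - p)^2 <= 0, so that
    G = p almost everywhere and N(G) <= A.

    The argument up to this point takes place on a measure space exhausted by
    sets of finite measure, for a homogeneous bounded operator with values
    >= 0. Balls exhaust R^n x R^m, and their measurability and finite measure are
    consequences of the axioms of a ball Banach function space; the operator is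
    the strong maximal operator. *)

Set Implicit Arguments.
Unset Strict Implicit.
Unset Printing Implicit Defensive.

Import Order.TTheory GRing.Theory Num.Theory.
Import numFieldNormedType.Exports.

Local Open Scope classical_set_scope.
Local Open Scope ring_scope.
Local Open Scope ereal_scope.

(** * Projection in L^2 *)

Lemma sum_half_powers (R : realType) k :
  (\sum_(0 <= i < k) (2 ^+ i)^-1 = 2 - 2 * (2 ^+ k)^-1 :> R)%R.
Proof.
elim: k => [|k ih]; first by rewrite big_geq// expr0 invr1 mulr1 subrr.
by rewrite big_nat_recr//= ih exprS invfM; field; rewrite expf_neq0.
Qed.

(** By the arithmetic-geometric mean inequality |a| <= 2^-k + 2^k a^2, so the
    telescoping series of the increments converges absolutely. This turns an
    integral bound on squared increments into almost everywhere convergence. *)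
Lemma cvg_weighted_increments (R : realType) (u : nat -> R) :
  \sum_(0 <= k <oo) (2 ^+ k * (u k.+1 - u k) ^+ 2)%:E < +oo -> cvgn u.
Proof.
set S := (X in X < _) => Soo.
pose v k := (u k.+1 - u k)%R.
have S0 : 0 <= S by apply: nneseries_ge0 => k _ _; rewrite lee_fin mulr_ge0// sqr_ge0.
have Sfin : S \is a fin_num by rewrite ge0_fin_numE.
suff /cvg_ex[l vl] : cvgn (series v).
  have uE : u = (fun k => u 0%N + series v k)%R.
    apply/funext => k; rewrite /series /= /v telescope_sumr//.
    by rewrite addrC subrK.
  rewrite uE; apply/cvg_ex; exists (u 0%N + l)%R.
  apply: cvgD; last exact: vl.
  exact: cvg_cst.
apply: (@normed_cvg R R^o).
apply: (@nondecreasing_is_cvgn R).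
  by apply: nondecreasing_series => k _ _ /=.
exists (2 + fine S)%R => _ [k _ <-].
rewrite /series /=.
apply: (@le_trans _ _
  (\sum_(0 <= i < k) ((2 ^+ i)^-1 + 2 ^+ i * v i ^+ 2)))%R.
  apply: ler_sum => i _.
  have p0 : (0 < 2 ^+ i :> R)%R by rewrite exprn_gt0.
  have -> : (v i ^+ 2 = `|v i| ^+ 2)%R by rewrite real_normK// num_real.
  set w := (`|v i|)%R; set a := (2 ^+ i)%R in p0 *.
  (* clearing the denominator a leaves a w <= 1 + (a w)^2 *)
  rewrite -[leLHS](mulKf (lt0r_neq0 p0)) -[X in (_ <= _ + X)%R](mulKf (lt0r_neq0 p0)).
  rewrite -[X in (_ <= X + _)%R]mulr1 -mulrDr ler_pM2l ?invr_gt0//.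
  have := sqr_ge0 (a * w - 1); nra.
rewrite big_split /= lerD//.
  by rewrite sum_half_powers gerBl mulr_ge0// invr_ge0 exprn_ge0.
rewrite -lee_fin fineK// -sumEFin.
apply: nneseries_lim_ge => i _ _.
by rewrite lee_fin mulr_ge0// sqr_ge0.
Qed.

Section nearest_point.
Context d (T : measurableType d) (R : realType) (mu : {measure set T -> \bar R}).

Definition sqdist (p q : T -> R) : \bar R := \int[mu]_z ((p z - q z) ^+ 2)%:E.

Lemma measurable_sqdist (p q : T -> R) :
  measurable_fun setT p -> measurable_fun setT q ->
  measurable_fun setT (fun z => ((p z - q z) ^+ 2)%:E).
Proof.
move=> mp mq; apply/measurable_EFinP; apply: measurable_funX.
exact: measurable_funB.
Qed.

Lemma sqdist_ge0 p q : 0 <= sqdist p q.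
Proof. by apply: integral_ge0 => z _; rewrite lee_fin sqr_ge0. Qed.

Lemma sqdist_parallelogram (g p q : T -> R) : measurable_fun setT g ->
    measurable_fun setT p -> measurable_fun setT q ->
  sqdist g p + sqdist g q =
  2%:E * sqdist g (fun z => (p z + q z) / 2)%R + 2^-1%:E * sqdist p q.
Proof.
move=> mg mp mq.
have mm : measurable_fun setT (fun z => (p z + q z) / 2)%R.
  by apply: measurable_funM => //; exact: measurable_funD.
rewrite /sqdist -!ge0_integralZl_EFin//; try exact: measurable_sqdist;
  try by move=> z _; rewrite lee_fin sqr_ge0.
rewrite -!ge0_integralD//;
  try (by apply: measurable_funeM; exact: measurable_sqdist);
  try exact: measurable_sqdist;
  try by move=> z _; rewrite ?mule_ge0// lee_fin sqr_ge0.
apply: eq_integral => z _; rewrite -!EFinM -!EFinD; congr EFin.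
by field.
Qed.

(** The Hilbert space projection onto a convex closed set, for a set K of
    functions lying between 0 and g. A minimizing sequence has small squared
    increments by the parallelogram law; choosing it geometrically close to the
    infimum makes it converge almost everywhere, and Fatou's lemma shows that
    its limit is a minimizer. Closedness of K is asked for almost everywhere
    limits, which is what the Fatou property of a function norm provides. *)
Lemma exists_nearest_point (g : T -> R) (K : set (T -> R)) :
  measurable_fun setT g -> \int[mu]_z ((g z) ^+ 2)%:E < +oo ->
  K (fun=> 0%R) ->
  (forall p : T -> R, K p -> measurable_fun setT p /\ forall z, (0 <= p z <= g z)%R) ->
  (forall p q : T -> R, K p -> K q -> K (fun z => (p z + q z) / 2)%R) ->
  (forall (u : nat -> T -> R) (p : T -> R), (forall k, K (u k)) -> measurable_fun setT p ->
     (forall z, (0 <= p z <= g z)%R) ->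
     (\forall z \ae mu, u ^~ z @ \oo --> p z) -> K p) ->
  exists2 p, K p & forall q, K q -> sqdist g p <= sqdist g q.
Proof.
move=> mg goo K0 Kb Kmid Kcl.
pose d0 := ereal_inf [set sqdist g q | q in K].
have d0_ge0 : 0 <= d0 by apply: le_ereal_inf_tmp => _ [q _ <-]; exact: sqdist_ge0.
have d0_le q : K q -> d0 <= sqdist g q.
  by move=> Kq; apply: ereal_inf_lbound; exists q.
have d0_fin : d0 \is a fin_num.
  rewrite ge0_fin_numE//; apply: (le_lt_trans (d0_le _ K0)).
  by rewrite /sqdist; under eq_integral do rewrite subr0.
have /choice[u uP] k : exists q, K q /\ sqdist g q <= d0 + ((4 ^+ k)^-1)%:E.
  have e0 : (0 < (4 ^+ k)^-1 :> R)%R by rewrite invr_gt0 exprn_gt0.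
  have [_ [q Kq <-] /ltW] := lb_ereal_inf_adherent e0 d0_fin.
  by exists q.
have Ku k : K (u k) by case: (uP k).
have mu_ k : measurable_fun setT (u k) by have [] := Kb _ (Ku k).
have Du k : sqdist g (u k) <= d0 + ((4 ^+ k)^-1)%:E by case: (uP k).
have incr k : sqdist (u k.+1) (u k) <= (4 * (4 ^+ k)^-1)%:E.
  have P := sqdist_parallelogram mg (mu_ k.+1) (mu_ k).
  have M : 2%:E * d0 <= 2%:E * sqdist g (fun z => (u k.+1 z + u k z) / 2)%R.
    by rewrite lee_pmul2l//; apply: d0_le; exact: Kmid.
  have {P M} : 2%:E * d0 + 2^-1%:E * sqdist (u k.+1) (u k) <=
      (d0 + ((4 ^+ k.+1)^-1)%:E) + (d0 + ((4 ^+ k)^-1)%:E).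
    apply: (@le_trans _ _ (sqdist g (u k.+1) + sqdist g (u k))).
      by rewrite P; exact: leeD.
    by apply: leeD; exact: Du.
  move: d0_fin; case: (d0) => // d1 _.
  have := sqdist_ge0 (u k.+1) (u k); case: (sqdist _ _) => [s|//|//]; last first.
    by rewrite gt0_muley ?lte_fin ?invr_gt0.
  rewrite -!EFinM -!EFinD !lee_fin => s0.
  have : (0 < 4 ^+ k :> R)%R by rewrite exprn_gt0.
  rewrite -invr_gt0 exprS invfM; lra.
have cvg_u : \forall z \ae mu, cvgn (u ^~ z).
  pose W z := \sum_(0 <= k <oo) (2 ^+ k * (u k.+1 z - u k z) ^+ 2)%:E.
  have mWk k : measurable_fun setT (fun z => (2 ^+ k * (u k.+1 z - u k z) ^+ 2)%:E).
    under eq_fun do rewrite EFinM.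
    by apply: measurable_funeM; exact: measurable_sqdist.
  have Wk0 k z : setT z -> 0 <= (2 ^+ k * (u k.+1 z - u k z) ^+ 2)%:E.
    by move=> _; rewrite lee_fin mulr_ge0 ?sqr_ge0.
  have iW : mu.-integrable setT W.
    apply/integrableP; split.
      apply: (ge0_emeasurable_sum (P := xpredT)) => [k z _ _|k _]; [exact: Wk0|exact: mWk].
    under eq_integral.
      move=> z _; rewrite gee0_abs; last by apply: nneseries_ge0 => k _ _; exact: Wk0.
      over.
    rewrite integral_nneseries//.
    apply: (@le_lt_trans _ _ 8%:E); last exact: ltry.
    apply: le_trans (@epsilon_trick0 R 8 xpredT _) => //.
    apply: lee_nneseries => [k _ _|k _]; first by apply: integral_ge0 => z; exact: Wk0.
    under eq_integral do rewrite EFinM.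
    rewrite ge0_integralZl_EFin//; [|by move=> z _; rewrite lee_fin sqr_ge0|
      exact: measurable_sqdist].
    apply: (@le_trans _ _ ((2 ^+ k)%:E * (4 * (4 ^+ k)^-1)%:E)).
      by rewrite lee_pmul2l//; exact: incr.
    rewrite -EFinM lee_fin expnS natrM natrX.
    have -> : (4 ^+ k = 2 ^+ k * 2 ^+ k :> R)%R.
      by rewrite -exprMn; congr (_ ^+ _)%R; ring.
    have : (2 ^+ k != 0 :> R)%R by rewrite expf_neq0.
    move: (2 ^+ k)%R => a.
    by move=> a0; rewrite le_eqVlt; apply/orP; left; apply/eqP; field.
  have := integrable_ae measurableT iW.
  apply: filterS => z /(_ I).
  rewrite ge0_fin_numE; last by apply: nneseries_ge0 => k _ _; exact: Wk0.
  exact: cvg_weighted_increments.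
(* the upper limit is everywhere defined and measurable, and agrees almost
   everywhere with the limit *)
pose p z := fine (limn_esup (fun k => (u k z)%:E)).
have ubnd k z : (0 <= u k z <= g z)%R by have [_] := Kb _ (Ku k).
have lb z : 0%:E <= limn_esup (fun k => (u k z)%:E) <= (g z)%:E.
  rewrite limn_esup_lim; apply/andP; split.
    apply: lime_ge; first exact: is_cvg_esups.
    near=> k; apply: (@le_trans _ _ (u k z)%:E).
      by rewrite lee_fin; have /andP[] := ubnd k z.
    by apply: ereal_sup_ubound; exists k => //=.
  apply: lime_le; first exact: is_cvg_esups.
  near=> k; apply: ge_ereal_sup => _ [j _ <-] /=.
  by rewrite lee_fin; have /andP[] := ubnd j z.
have pE z : limn_esup (fun k => (u k z)%:E) = (p z)%:E.
  have /andP[l0 lg] := lb z.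
  by rewrite fineK// ge0_fin_numE//; exact: le_lt_trans lg (ltry _).
have mp : measurable_fun setT p.
  apply/measurable_EFinP.
  have -> : EFin \o p = fun z => limn_esup (fun k => (u k z)%:E).
    by apply/funext => z; rewrite pE.
  by apply: measurable_fun_limn_esup => k; exact/measurable_EFinP.
have pb z : (0 <= p z <= g z)%R by rewrite -!lee_fin -pE.
have up : \forall z \ae mu, u ^~ z @ \oo --> p z.
  apply: filterS cvg_u => z /cvg_ex[l ul].
  suff -> : p z = l by [].
  have ulE : (fun k => (u k z)%:E) @ \oo --> l%:E.
    by apply: cvg_EFin; [exact: nearW|exact: ul].
  have [_] := cvg_limn_einf_sup ulE.
  by rewrite pE => -[].
have Kp : K p by exact: (Kcl u).
exists p => // q Kq; apply: le_trans (d0_le _ Kq).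
rewrite /sqdist.
pose D k z := ((g z - u k z) ^+ 2)%:E.
have mD k : measurable_fun setT (D k) by exact: measurable_sqdist.
have D0 k z : 0 <= D k z by rewrite lee_fin sqr_ge0.
have limD : \forall z \ae mu, limn_einf (D ^~ z) = ((g z - p z) ^+ 2)%:E.
  apply: filterS up => z uz.
  have [] // := @cvg_limn_einf_sup _ (D ^~ z) ((g z - p z) ^+ 2)%:E.
  apply: cvg_EFin; first exact: nearW.
  by apply: cvgM; apply: cvgB => //; exact: cvg_cst.
have lD0 z : 0 <= limn_einf (D ^~ z).
  rewrite limn_einf_lim; apply: lime_ge; first exact: is_cvg_einfs.
  by apply: nearW => k; apply: le_ereal_inf_tmp => _ [j _ <-]; exact: D0.
have mlD : measurable_fun setT (fun z => limn_einf (D ^~ z)).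
  apply: measurableT_comp => //.
  apply: measurable_fun_limn_esup => k.
  exact: measurableT_comp.
have -> : \int[mu]_z ((g z - p z) ^+ 2)%:E = \int[mu]_z (limn_einf (D ^~ z)).
  apply: ge0_ae_eq_integral => //.
  - exact: measurable_sqdist.
  - by move=> z _; rewrite lee_fin sqr_ge0.
  - by apply: filterS limD => z ->.
apply: le_trans (fatou _ _ _ _) _ => //.
suff Dd : (fun k => \int[mu]_z D k z) @ \oo --> d0 by rewrite (cvg_limn_einf_sup Dd).1.
apply: (@squeeze_cvge _ _ _ _ (fun=> d0) _ (fun k => d0 + ((4 ^+ k)^-1)%:E)).
- by apply: nearW => k; rewrite d0_le ?Du.
- exact: cvg_cst.
- rewrite -[X in _ --> X]adde0; apply: cvgeD; [by rewrite fin_num_adde_defl|exact: cvg_cst|].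
  apply: cvg_EFin; first exact: nearW.
  have : (fun k => geometric 1 (4^-1) k : R) @ \oo --> (0%R : R).
    by apply: cvg_geometric; rewrite ger0_norm ?invr_ge0// invf_lt1 ?ltr1n.
  apply: cvg_trans; apply: near_eq_cvg; apply: nearW => k.
  by rewrite /geometric /= mul1r exprVn.
Unshelve. all: by end_near.
Qed.

(** First-order condition at a nearest point p in the direction of f. The
    competitor is cut at g, which keeps it between 0 and g and can only bring
    it closer to g; expanding the square of (g - p) - t (f - p) and letting t
    tend to 0 gives the inequality. *)
Lemma nearest_point_variational (g p f : T -> R) :
  measurable_fun setT g -> measurable_fun setT p -> measurable_fun setT f ->
  \int[mu]_z ((g z) ^+ 2)%:E < +oo -> \int[mu]_z ((f z) ^+ 2)%:E < +oo ->
  (forall z, (0 <= p z <= g z)%R) -> (forall z, (0 <= f z)%R) ->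
  (forall t : R, (0 < t <= 1)%R ->
    sqdist g p <= sqdist g (fun z => Num.min (g z) ((1 - t) * p z + t * f z)%R)) ->
  \int[mu]_z ((g z - p z) * f z)%:E <= \int[mu]_z ((g z - p z) * p z)%:E.
Proof.
move=> mg mp mf goo foo pg f0 pmin.
have p0 z : (0 <= p z)%R by case/andP: (pg z).
have pleg z : (p z <= g z)%R by case/andP: (pg z).
set a := integral _ _ _; set b := integral _ _ _.
pose c := sqdist f p.
have mgp : measurable_fun setT (fun z => g z - p z)%R by exact: measurable_funB.
have ma : measurable_fun setT (fun z => ((g z - p z) * f z)%:E).
  by apply/measurable_EFinP; exact: measurable_funM.
have mb : measurable_fun setT (fun z => ((g z - p z) * p z)%:E).
  by apply/measurable_EFinP; exact: measurable_funM.
have msq (h : T -> R) : measurable_fun setT h -> measurable_fun setT (fun z => (h z ^+ 2)%:E).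
  by move=> mh; apply/measurable_EFinP; exact: measurable_funX.
have a0 : 0 <= a.
  by apply: integral_ge0 => z _; rewrite lee_fin mulr_ge0// subr_ge0.
have b0 : 0 <= b.
  by apply: integral_ge0 => z _; rewrite lee_fin mulr_ge0// subr_ge0.
have c0 : 0 <= c by exact: sqdist_ge0.
have bfin : b \is a fin_num.
  rewrite ge0_fin_numE//; apply: le_lt_trans goo.
  apply: ge0_le_integral => //.
  - by move=> z _; rewrite lee_fin mulr_ge0// subr_ge0.
  - exact: msq.
  - by move=> z _; rewrite lee_fin; have := p0 z; have := pleg z; nra.
have Dfin : sqdist g p \is a fin_num.
  rewrite ge0_fin_numE ?sqdist_ge0//; apply: le_lt_trans goo.
  apply: ge0_le_integral => //.
  - by move=> z _; rewrite lee_fin sqr_ge0.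
  - exact: measurable_sqdist.
  - exact: msq.
  - by move=> z _; rewrite lee_fin; have := p0 z; have := pleg z; nra.
have cfin : c \is a fin_num.
  rewrite ge0_fin_numE//.
  apply: (@le_lt_trans _ _ (\int[mu]_z ((f z ^+ 2)%:E + (g z ^+ 2)%:E))).
    apply: ge0_le_integral => //.
    - by move=> z _; rewrite lee_fin sqr_ge0.
    - exact: measurable_sqdist.
    - by apply: emeasurable_funD; exact: msq.
    - move=> z _; rewrite -EFinD lee_fin.
      by have := p0 z; have := pleg z; have := f0 z; nra.
  rewrite ge0_integralD//; try exact: msq; try by move=> z _; rewrite lee_fin sqr_ge0.
  exact: lte_add_pinfty.
have main (t : R) : (0 < t <= 1)%R ->
    sqdist g p + (2 * t)%:E * a <= sqdist g p + ((2 * t)%:E * b + (t ^+ 2)%:E * c).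
  move=> /[dup] t01 /andP[t0 t1].
  pose q z := Num.min (g z) ((1 - t) * p z + t * f z)%R.
  have mq : measurable_fun setT q.
    apply: measurable_minr => //.
    by apply: measurable_funD; apply: measurable_funM.
  apply: (@le_trans _ _ (sqdist g q + (2 * t)%:E * a)).
    by apply: leeD => //; exact: pmin.
  have t20 : (0 <= 2 * t)%R by rewrite mulr_ge0// ltW.
  have nf z : 0 <= ((g z - p z) * f z)%:E by rewrite lee_fin mulr_ge0// subr_ge0.
  have np z : 0 <= ((g z - p z) * p z)%:E by rewrite lee_fin mulr_ge0// subr_ge0.
  have nsq (h k : T -> R) z : 0 <= ((h z - k z) ^+ 2)%:E by rewrite lee_fin sqr_ge0.
  have ntf z : 0 <= (2 * t)%:E * ((g z - p z) * f z)%:E by rewrite mule_ge0.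
  have ntp z : 0 <= (2 * t)%:E * ((g z - p z) * p z)%:E by rewrite mule_ge0.
  have ntq z : 0 <= (t ^+ 2)%:E * ((f z - p z) ^+ 2)%:E by rewrite mule_ge0 ?lee_fin ?sqr_ge0.
  have mq2 (h : T -> R) : measurable_fun setT h ->
    measurable_fun setT (fun z => ((g z - h z) ^+ 2)%:E) by exact: measurable_sqdist.
  have mtf : measurable_fun setT (fun z => (2 * t)%:E * ((g z - p z) * f z)%:E).
    exact: measurable_funeM.
  have mtp : measurable_fun setT (fun z => (2 * t)%:E * ((g z - p z) * p z)%:E).
    exact: measurable_funeM.
  have mfp : measurable_fun setT (fun z => ((f z - p z) ^+ 2)%:E).
    exact: measurable_sqdist.
  have mtq : measurable_fun setT (fun z => (t ^+ 2)%:E * ((f z - p z) ^+ 2)%:E).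
    exact: measurable_funeM.
  rewrite /a /b /c /sqdist -(ge0_integralZl_EFin _ _ _ ma)// -(ge0_integralZl_EFin _ _ _ mb)//.
  rewrite -(ge0_integralZl_EFin _ _ _ mfp) ?sqr_ge0//.
  rewrite -ge0_integralD//; last exact: mq2.
  rewrite -ge0_integralD// -ge0_integralD//; last 3 first.
  - exact: mq2.
  - by move=> z _; rewrite adde_ge0.
  - exact: emeasurable_funD.
  apply: ge0_le_integral => //.
  - by move=> z _; rewrite adde_ge0.
  - by apply: emeasurable_funD => //; exact: mq2.
  - by apply: emeasurable_funD; [exact: mq2|exact: emeasurable_funD].
  move=> z _; rewrite -!EFinM -!EFinD lee_fin /q.
  (* the square of g - ((1 - t) p + t f) is that of (g - p) - t (f - p) *)
  have E : ((g z - p z) ^+ 2 + (2 * t * ((g z - p z) * p z) + t ^+ 2 * (f z - p z) ^+ 2)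
     = (g z - ((1 - t) * p z + t * f z)) ^+ 2 + 2 * t * ((g z - p z) * f z))%R by ring.
  rewrite E lerD2r /Num.min; case: ifPn => _ //.
  by rewrite subrr expr0n sqr_ge0.
move: main; rewrite -/a -/b; clearbody a b c.
move: Dfin a0 b0 c0 bfin cfin; case: (sqdist g p) => // D _.
case: b => // b; case: c => // c; case: a => [a||//]; last first.
  move=> _ _ _ _ _ /(_ 1%R); rewrite ltr01 lexx => /(_ isT).
  by rewrite mulr1 gt0_muley ?lte_fin// addey// -!EFinM -!EFinD leye_eq.
rewrite !lee_fin => a0 b0 c0 _ _ main.
apply/ler_addgt0Pr => e e0.
have c1 : (0 < c + e + 1)%R by lra.
(* c + e + 1 makes t at most 1 and t c at most e *)
have /main : (0 < e / (c + e + 1) <= 1)%R.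
  by rewrite divr_gt0//= ler_pdivrMr// mul1r; lra.
rewrite -!EFinM -!EFinD lee_fin; set t := (e / _)%R => h.
have t0 : (0 < t)%R by rewrite divr_gt0.
have tc : (t * (c + e + 1) = e)%R by rewrite /t divfK// gt_eqF.
have {h} : (2 * a <= 2 * b + t * c)%R.
  rewrite -(ler_pM2l t0).
  by move: h; rewrite lerD2l; lra.
nra.
Qed.

End nearest_point.

(** * Truncation to bounded functions *)

Section truncation.
Context d (E : measurableType d) (R : realType) (B : nat -> set E).

(** The value is real and, when B k has finite measure, its square is
    integrable, so that the projection argument applies to it. *)
Definition trunc (f : E -> \bar R) k (z : E) : R :=
  (fine (mine (f z) k%:R%:E) * \1_(B k) z)%R.

Lemma trunc_fin (f : E -> \bar R) k z : 0 <= f z ->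
  mine (f z) k%:R%:E \is a fin_num.
Proof.
move=> f0; rewrite ge0_fin_numE; last by rewrite le_min f0 lee_fin ler0n.
by apply: le_lt_trans (ltry k%:R); rewrite ge_min lexx orbT.
Qed.

Lemma trunc_ge0 (f : E -> \bar R) k z : 0 <= f z -> (0 <= trunc f k z)%R.
Proof.
move=> f0; rewrite mulr_ge0 ?fine_ge0// ?le_min ?f0 ?lee_fin ?ler0n//.
Qed.

Lemma trunc_le_cst (f : E -> \bar R) k z : 0 <= f z ->
  (trunc f k z <= k%:R * \1_(B k) z)%R.
Proof.
move=> f0; rewrite ler_wpM2r// -lee_fin fineK ?trunc_fin//.
by rewrite ge_min lexx orbT.
Qed.

Lemma trunc_le (f : E -> \bar R) k z : 0 <= f z -> (trunc f k z)%:E <= f z.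
Proof.
move=> f0; rewrite /trunc indicE; case: (_ \in _); last by rewrite mulr0.
by rewrite mulr1 fineK ?trunc_fin// ge_min lexx.
Qed.

Lemma trunc_nondecreasing (f : E -> \bar R) k z :
  (B k `<=` B k.+1) -> 0 <= f z ->
  (trunc f k z <= trunc f k.+1 z)%R.
Proof.
move=> Bnd f0; rewrite /trunc; apply: ler_pM => //.
- by rewrite fine_ge0// le_min f0 lee_fin ler0n.
- rewrite -lee_fin !fineK ?trunc_fin// le_min !ge_min lexx/=.
  by rewrite lee_fin ler_nat leqnSn orbT.
- rewrite !indicE ler_nat.
  case: (boolP (z \in B k)) => // /set_mem zk.
  by rewrite mem_set//; exact: Bnd.
Qed.

Lemma cvg_trunc (f : E -> \bar R) z :
  (\forall k \near \oo, B k z) -> 0 <= f z ->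
  (trunc f k z)%:E @[k --> \oo] --> f z.
Proof.
move=> Bnear f0.
have near_ball : \forall k \near \oo, (trunc f k z)%:E = mine (f z) k%:R%:E.
  near=> k.
  rewrite /trunc indicE mem_set ?mulr1 ?fineK ?trunc_fin//=.
  by near: k; exact: Bnear.
move: f0 near_ball; case: (f z) => [r||//] r0 near_ball.
- apply: cvg_near_cst.
  near=> k; rewrite (near near_ball k)//; apply/min_idPl.
  rewrite lee_fin; near: k; exact: nbhs_infty_ger.
- apply/cvgeyPge => A; near=> k; rewrite (near near_ball k)// minye.
  by rewrite lee_fin; near: k; exact: nbhs_infty_ger.
Unshelve. all: by end_near.
Qed.

Lemma measurable_trunc (f : E -> \bar R) k : measurable (B k) ->
  measurable_fun setT f -> measurable_fun setT (trunc f k).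
Proof.
move=> mB mf; apply: measurable_funM; last exact: measurable_indic.
apply: (measurableT_comp (fine_measurable measurableT)).
exact: measurable_mine.
Qed.

End truncation.

(** * Function norms and the Lorentz-Luxemburg theorem *)

Section function_norm.
Context d (E : measurableType d) (R : realType) (mu : {measure set E -> \bar R}).
Implicit Types (N : (E -> \bar R) -> \bar R) (f g h : E -> \bar R).

(** A norm on extended real functions, infinite outside the space, that is
    solid and has the Fatou property. *)
Record function_norm N : Prop := {
  fnorm_ge0 : forall f, measurable_fun setT f -> 0 <= N f ;
  fnormZ : forall (c : R) f, measurable_fun setT f -> (0 <= c)%R ->
    N (fun z => c%:E * f z) = c%:E * N f ;
  fnormD : forall f g, measurable_fun setT f -> measurable_fun setT g ->
    N (f \+ g) <= N f + N g ;
  fnorm_le_ae : forall f g, measurable_fun setT f -> measurable_fun setT g ->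
    (\forall z \ae mu, `|g z| <= `|f z|) -> N g <= N f ;
  fnorm_fatou : forall (u : nat -> E -> \bar R) f,
    (forall k, measurable_fun setT (u k)) -> measurable_fun setT f ->
    (\forall z \ae mu, (forall k, 0 <= u k z <= u k.+1 z) /\
                         u k z @[k --> \oo] --> f z) ->
    N (u k) @[k --> \oo] --> N f }.

(** The norm of the associate (Köthe dual) space. *)
Definition dual_norm N h : \bar R :=
  ereal_sup [set \int[mu]_z `|h z * g z|
            | g in [set g | measurable_fun setT g /\ N g <= 1]].

End function_norm.

Section saturation.
Context d (E : measurableType d) (R : realType) (mu : {measure set E -> \bar R}).
Variable N : (E -> \bar R) -> \bar R.
Hypothesis hN : function_norm mu N.
Local Notation mfunction f := (measurable_fun setT f).

Let NZ (c : R) f : mfunction f -> (0 <= c)%R ->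
  N (fun z => c%:E * f z) = c%:E * N f.
Proof. exact: fnormZ hN _ _. Qed.

Let ND f g : mfunction f -> mfunction g -> N (f \+ g) <= N f + N g.
Proof. exact: fnormD hN _ _. Qed.

Let N_le_ae f g : mfunction f -> mfunction g ->
  (\forall z \ae mu, `|g z| <= `|f z|) -> N g <= N f.
Proof. exact: fnorm_le_ae hN _ _. Qed.

Let N_le f g : mfunction f -> mfunction g ->
  (forall z, `|g z| <= `|f z|) -> N g <= N f.
Proof. by move=> mf mg gf; apply: N_le_ae => //; exact: aeW. Qed.

Let N0 : N (fun=> 0) = 0.
Proof.
have := @NZ 0%R (fun=> 0) (@measurable_cst _ _ _ _ _ _) (lexx _).
by rewrite !mul0e.
Qed.

Variable B : nat -> set E.
Hypothesis mB : forall k, measurable (B k).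
Hypothesis B_fin : forall k, mu (B k) < +oo.
Hypothesis B_nd : forall k, B k `<=` B k.+1.
Hypothesis B_near : forall z, \forall k \near \oo, B k z.
Local Notation trunc := (trunc B).

Lemma trunc_square_integrable f k : mfunction f -> (forall z, 0 <= f z) ->
  \int[mu]_z ((trunc f k z) ^+ 2)%:E < +oo.
Proof.
move=> mf f0.
have mt : measurable_fun setT (trunc f k) by exact: measurable_trunc.
apply: (@le_lt_trans _ _ (\int[mu]_z ((k%:R ^+ 2)%:E * (\1_(B k) z)%:E))).
  apply: ge0_le_integral => //.
  - by move=> z _; rewrite lee_fin sqr_ge0.
  - by apply/measurable_EFinP; exact: measurable_funX.
  - by apply: measurable_funeM; apply/measurable_EFinP; exact: measurable_indic.
  - move=> z _; rewrite -EFinM lee_fin.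
    apply: (@le_trans _ _ ((k%:R * \1_(B k) z) ^+ 2))%R.
      by rewrite ler_pXn2r ?nnegrE ?trunc_ge0 ?mulr_ge0 ?trunc_le_cst.
    by rewrite exprMn ler_wpM2l// indicE; case: (_ \in _); rewrite ?expr1n ?expr0n.
rewrite ge0_integralZl_EFin//; last by apply/measurable_EFinP; exact: measurable_indic.
rewrite integral_indic// setIT.
by apply: lte_mul_pinfty => //; exact: sqr_ge0.
Qed.

Local Notation N' := (dual_norm mu N).

Lemma dual_norm_ge0 h : 0 <= N' h.
Proof.
apply: le_trans (ereal_sup_ubound _); last first.
  by exists (fun=> 0); [split; [exact: measurable_cst|rewrite N0]|reflexivity].
exact: integral_ge0.
Qed.

(** Closedness of the balls of N under almost everywhere limits: the tail
    infima of the sequence increase to its limit and are dominated by it. *)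
Lemma norm_le_ae_limit (u : nat -> E -> R) (p : E -> R) (A : \bar R) :
  (forall k, measurable_fun setT (u k)) -> measurable_fun setT p ->
  (forall k z, 0 <= u k z)%R -> (forall k, N (EFin \o u k) <= A) ->
  (\forall z \ae mu, u ^~ z @ \oo --> p z) -> N (EFin \o p) <= A.
Proof.
move=> mu_ mp u0 uA up.
pose v k z := einfs (fun j => (u j z)%:E) k.
have mv k : mfunction (v k).
  by apply: measurable_fun_einfs => j; exact/measurable_EFinP.
have v0 k z : 0 <= v k z.
  by apply: le_ereal_inf_tmp => _ [j _ <-]; rewrite lee_fin.
have vu k z : v k z <= (u k z)%:E by apply: ereal_inf_lbound; exists k => /=.
have Nv : N (v k) @[k --> \oo] --> N (EFin \o p).
  apply: (fnorm_fatou hN) => //; first exact/measurable_EFinP.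
  apply: filterS up => z uz; split.
    move=> k; rewrite v0/=; exact: nondecreasing_einfs.
  by apply: cvg_einfs; apply: cvg_EFin; [exact: nearW|exact: uz].
rewrite -(cvg_lim _ Nv)//; apply: lime_le; first by apply/cvg_ex; exists (N (EFin \o p)).
apply: nearW => k; apply: le_trans (uA k); apply: N_le => //; first exact/measurable_EFinP.
by move=> z; rewrite !gee0_abs// lee_fin.
Qed.

Lemma norm_convex (p q : E -> R) (A t : R) : (0 <= t <= 1)%R ->
  measurable_fun setT p -> measurable_fun setT q ->
  N (EFin \o p) <= A%:E -> N (EFin \o q) <= A%:E ->
  N (fun z => ((1 - t) * p z + t * q z)%:E) <= A%:E.
Proof.
move=> /andP[t0 t1] mp mq pA qA.
have mp' : mfunction (EFin \o p) by exact/measurable_EFinP.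
have mq' : mfunction (EFin \o q) by exact/measurable_EFinP.
have s0 : (0 <= 1 - t)%R by rewrite subr_ge0.
have -> : (fun z => ((1 - t) * p z + t * q z)%:E) =
  (fun z => (1 - t)%:E * (EFin \o p) z) \+ (fun z => t%:E * (EFin \o q) z) by [].
apply: le_trans (ND _ _) _; [exact: measurable_funeM|exact: measurable_funeM|].
rewrite !NZ//; apply: (@le_trans _ _ ((1 - t)%:E * A%:E + t%:E * A%:E)).
  by apply: leeD; apply: lee_wpmul2l; rewrite ?lee_fin.
by rewrite -!EFinM -EFinD lee_fin -mulrDl subrK mul1r.
Qed.

(** The separation step. With g the truncation and p the point nearest to g in
    the part of the ball of radius A that lies below g, the function h = g - p
    satisfies, by the variational inequality, int h f <= int h p for all f >= 0
    of norm at most A. Hence A N'(h) <= int h p, and testing the hypothesis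
    against h gives int g h <= int p h, that is int (g - p)^2 <= 0. *)
Lemma lorentz_luxemburg_trunc (G : E -> \bar R) (A : R) k : (0 < A)%R -> mfunction G ->
  (forall z, 0 <= G z) ->
  (forall h : E -> R, measurable_fun setT h -> (forall z, 0 <= h z)%R ->
    N' (EFin \o h) < +oo ->
    \int[mu]_z (trunc G k z * h z)%:E <= A%:E * N' (EFin \o h)) ->
  N (EFin \o trunc G k) <= A%:E.
Proof.
move=> A0 mG G0 hA.
pose g := trunc G k.
have mg : measurable_fun setT g by exact: measurable_trunc.
have g0 z : (0 <= g z)%R by exact: trunc_ge0.
have goo : \int[mu]_z ((g z) ^+ 2)%:E < +oo by exact: trunc_square_integrable.
pose K := [set p : E -> R | [/\ measurable_fun setT p,
  forall z, (0 <= p z <= g z)%R & N (EFin \o p) <= A%:E]].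
have [p [mp pg pA] pmin] : exists2 p, K p & forall q, K q -> sqdist mu g p <= sqdist mu g q.
  apply: (@exists_nearest_point _ _ _ mu g K mg goo).
  - split => // [z|]; first by rewrite lexx g0.
    by rewrite (_ : _ \o _ = fun=> 0)// N0 lee_fin ltW.
  - by move=> p [].
  - move=> p q [mp pg pA] [mq qg qA]; split.
    + by apply: measurable_funM => //; exact: measurable_funD.
    + by move=> z; have /andP[] := pg z; have /andP[] := qg z; lra.
    + have := @norm_convex p q A 2^-1 _ mp mq pA qA.
      rewrite invr_ge0 ler0n invf_le1// ler1n => /(_ isT).
      apply: le_trans; rewrite (_ : EFin \o _ = fun z => ((1 - 2^-1) * p z + 2^-1 * q z)%:E)//.
      by apply/funext => z /=; congr EFin; field.
  - move=> u p Ku mp pg up; split => //.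
    apply: (@norm_le_ae_limit u) => //.
    + by move=> j; case: (Ku j).
    + by move=> j z; case: (Ku j) => _ /(_ z) /andP[].
    + by move=> j; case: (Ku j).
have p0 z : (0 <= p z)%R by case/andP: (pg z).
have pleg z : (p z <= g z)%R by case/andP: (pg z).
pose h z := (g z - p z)%R.
have mh : measurable_fun setT h by exact: measurable_funB.
have h0 z : (0 <= h z)%R by rewrite subr_ge0.
pose c := \int[mu]_z (h z * p z)%:E.
have test (f : E -> R) : measurable_fun setT f -> (forall z, 0 <= f z)%R ->
    \int[mu]_z ((f z) ^+ 2)%:E < +oo -> N (EFin \o f) <= A%:E ->
    \int[mu]_z (h z * f z)%:E <= c.
  move=> mf f0 foo fA; apply: nearest_point_variational => //.
  move=> t /andP[t0 t1]; apply: pmin.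
  have mq : measurable_fun setT (fun z => (1 - t) * p z + t * f z)%R.
    by apply: measurable_funD; apply: measurable_funM.
  have q0 z : (0 <= (1 - t) * p z + t * f z)%R.
    by rewrite addr_ge0// mulr_ge0// ?subr_ge0// ltW.
  split.
  - exact: measurable_minr.
  - by move=> z; rewrite le_min g0 q0 ge_min lexx.
  - have t01 : (0 <= t <= 1)%R by rewrite ltW.
    apply: le_trans (norm_convex t01 mp mf pA fA).
    apply: N_le; [exact/measurable_EFinP|by apply/measurable_EFinP; exact: measurable_minr|].
    move=> z; rewrite /= !ger0_norm ?le_min ?g0 ?q0// lee_fin ge_min lexx.
    by rewrite orbT.
have c0 : 0 <= c by apply: integral_ge0 => z _; rewrite lee_fin mulr_ge0.
have cfin : c \is a fin_num.
  rewrite ge0_fin_numE//; apply: le_lt_trans goo.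
  apply: ge0_le_integral => //.
  - by move=> z _; rewrite lee_fin mulr_ge0.
  - by apply/measurable_EFinP; exact: measurable_funM.
  - by apply/measurable_EFinP; exact: measurable_funX.
  - by move=> z _; rewrite lee_fin /h; have := p0 z; have := pleg z; nra.
have N'h : A%:E * N' (EFin \o h) <= c.
  rewrite muleC -lee_pdivlMr//.
  apply: ge_ereal_sup => _ [f [mf f1] <-].
  rewrite lee_pdivlMr//.
  pose F z := A%:E * `|f z|.
  have mF : mfunction F by apply: measurable_funeM; exact: measurableT_comp.
  have F0 z : 0 <= F z by rewrite mule_ge0// lee_fin ltW.
  have NF : N F <= A%:E.
    rewrite NZ ?(ltW A0)//; last exact: measurableT_comp.
    rewrite -[leRHS]mule1 lee_pmul2l//; apply: le_trans f1.
    by apply: N_le => //; [exact: measurableT_comp|move=> z; rewrite abse_id].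
  (* the variational inequality concerns square integrable functions: it is
     extended to F by monotone convergence along truncations *)
  have tr j : \int[mu]_z (h z * trunc F j z)%:E <= c.
    apply: test.
    - exact: measurable_trunc.
    - by move=> z; exact: trunc_ge0.
    - exact: trunc_square_integrable.
    - apply: le_trans NF; apply: N_le => //.
        by apply/measurable_EFinP; exact: measurable_trunc.
      by move=> z; rewrite !gee0_abs// ?lee_fin ?trunc_ge0// trunc_le.
  rewrite muleC -ge0_integralZl_EFin ?(ltW A0)//; last first.
    by apply: measurableT_comp => //; apply: emeasurable_funM => //; exact/measurable_EFinP.
  have -> : \int[mu]_z (A%:E * `|(EFin \o h) z * f z|) =
      \int[mu]_z limn (fun j => (h z * trunc F j z)%:E).
    apply: eq_integral => z _; apply/esym/cvg_lim => //.
    rewrite abseM gee0_abs ?lee_fin ?h0// muleCA.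
    under eq_fun do rewrite EFinM.
    by apply: cvgeZl => //; exact: cvg_trunc.
  have mtr j : measurable_fun setT (fun z => (h z * trunc F j z)%:E).
    by apply/measurable_EFinP; apply: measurable_funM => //; exact: measurable_trunc.
  have tr0 j z : 0 <= (h z * trunc F j z)%:E by rewrite lee_fin mulr_ge0// trunc_ge0.
  have trnd z : nondecreasing_seq (fun j => (h z * trunc F j z)%:E).
    apply/nondecreasing_seqP => j; rewrite lee_fin ler_wpM2l//.
    exact: trunc_nondecreasing.
  rewrite monotone_convergence//; apply: lime_le.
    apply: ereal_nondecreasing_is_cvgn => i j ij.
    by apply: ge0_le_integral => // z _; exact: trnd.
  exact: nearW.
have {}hA : \int[mu]_z (g z * h z)%:E <= c.
  apply: (le_trans _ N'h); apply: hA => //.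
  rewrite ltNge leye_eq; apply/negP => /eqP N'oo.
  by move: N'h; rewrite N'oo gt0_muley ?lte_fin// leye_eq => /eqP cE; rewrite cE in cfin.
have D0 : sqdist mu g p = 0.
  apply/le_anti; rewrite sqdist_ge0 andbT.
  have : c + sqdist mu g p <= c + 0.
    rewrite adde0; apply: le_trans hA.
    rewrite /c /sqdist -ge0_integralD//.
    - apply: ge0_le_integral => //.
      + by move=> z _; rewrite -EFinD lee_fin addr_ge0 ?sqr_ge0 ?mulr_ge0.
      + apply: emeasurable_funD; last exact: measurable_sqdist.
        by apply/measurable_EFinP; exact: measurable_funM.
      + by apply/measurable_EFinP; exact: measurable_funM.
      + by move=> z _; rewrite -EFinD lee_fin /h; nra.
    - by move=> z _; rewrite lee_fin mulr_ge0.
    - by apply/measurable_EFinP; exact: measurable_funM.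
    - by move=> z _; rewrite lee_fin sqr_ge0.
    - exact: measurable_sqdist.
  by rewrite leeD2lE.
have gp : \forall z \ae mu, g z = p z.
  have [ae0 _] := ae_eq_integral_abs mu measurableT (measurable_sqdist mg mp).
  have absD : \int[mu]_z `|((g z - p z) ^+ 2)%:E| = 0.
    by rewrite -[RHS]D0; apply: eq_integral => z _; rewrite gee0_abs// lee_fin sqr_ge0.
  have := ae0 absD; apply: filterS => z /(_ I) /= /eqP.
  by rewrite eqe sqrf_eq0 subr_eq0 => /eqP.
apply: le_trans pA; apply: N_le_ae; [exact/measurable_EFinP|exact/measurable_EFinP|].
by apply: filterS gp => z gpz; rewrite /= -/(g z) gpz.
Qed.

(** The half of the Lorentz-Luxemburg theorem N'' = N that does not follow from
    Hölder's inequality: the associate norm determines N on non-negative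
    functions. By the Fatou property it is enough to treat truncations; the
    bound a is relaxed to a + e because the separation step divides by it. *)
Lemma lorentz_luxemburg (G : E -> \bar R) (a : R) : (0 <= a)%R -> mfunction G ->
  (forall z, 0 <= G z) ->
  (forall h : E -> R, measurable_fun setT h -> (forall z, 0 <= h z)%R ->
    N' (EFin \o h) < +oo ->
    \int[mu]_z (G z * (h z)%:E) <= a%:E * N' (EFin \o h)) ->
  N G <= a%:E.
Proof.
move=> a0 mG G0 hG; apply/lee_addgt0Pr => e e0.
have mt k : mfunction (fun z => (trunc G k z)%:E).
  by apply/measurable_EFinP; exact: measurable_trunc.
have Nt : N (fun z => (trunc G k z)%:E) @[k --> \oo] --> N G.
  apply: (fnorm_fatou hN) => //; apply: aeW => z; split.
    by move=> k; rewrite !lee_fin trunc_ge0//= trunc_nondecreasing.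
  exact: cvg_trunc.
rewrite -(cvg_lim _ Nt)//; apply: lime_le; first by apply/cvg_ex; exists (N G).
apply: nearW => k; rewrite -EFinD.
apply: lorentz_luxemburg_trunc => //; first by rewrite ltr_wpDl.
move=> h mh h0 hoo; apply: (@le_trans _ _ (a%:E * N' (EFin \o h))); last first.
  apply: lee_wpmul2r; first exact: dual_norm_ge0.
  by rewrite lee_fin lerDl ltW.
apply: le_trans (hG h mh h0 hoo); apply: ge0_le_integral => //.
- by move=> z _; rewrite lee_fin mulr_ge0// trunc_ge0.
- by apply/measurable_EFinP; apply: measurable_funM => //; exact: measurable_trunc.
- by apply: emeasurable_funM => //; exact/measurable_EFinP.
- by move=> z _; rewrite EFinM; apply: lee_wpmul2r; rewrite ?lee_fin// trunc_le.
Qed.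

End saturation.

(** * The Rubio de Francia iteration *)

(** The factor x may be infinite: one nonzero term then makes the right-hand
    side infinite. *)
Lemma mule_nneseries_le (R : realType) (u : nat -> \bar R) (x : \bar R) :
  (forall k, 0 <= u k) -> 0 <= x ->
  x * \sum_(0 <= k <oo) u k <= \sum_(0 <= k <oo) (x * u k).
Proof.
move=> u0; case: x => [r r0||//].
  by rewrite nneseriesZl// => k _; exact: u0.
move=> _; have [all0|/existsNP[k /eqP uk]] := pselect (forall k, u k = 0).
  by rewrite eseries0 ?mule0 ?nneseries_ge0// => k _ _; rewrite all0 ?mule0.
suff -> : \sum_(0 <= k <oo) (+oo * u k) = +oo by rewrite leey.
have t0 i : 0 <= +oo * u i by rewrite mule_ge0.
apply/eqP; rewrite -leye_eq.
apply: le_trans (nneseries_lim_ge k.+1 _); last by move=> i _ _; exact: t0.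
rewrite big_nat_recr//= gt0_mulye; last by rewrite lt0e uk u0.
by rewrite addey// gt_eqF//; apply: (@lt_le_trans _ _ 0); [exact: ltNyr|exact: sume_ge0].
Qed.

Section extrapolation.
Context d (E : measurableType d) (R : realType) (mu : {measure set E -> \bar R}).
Variable N : (E -> \bar R) -> \bar R.
Hypothesis hN : function_norm mu N.
Implicit Types f g h : E -> \bar R.
Local Notation mfunction f := (measurable_fun setT f).
Local Notation N' := (dual_norm mu N).

Lemma dual_norm_ler h (M : \bar R) :
  (forall g, mfunction g -> N g <= 1 -> \int[mu]_z `|h z * g z| <= M) -> N' h <= M.
Proof. by move=> hM; apply: ge_ereal_sup => _ [g [mg g1] <-]; exact: hM. Qed.

Lemma integral_le_dual_norm h g : mfunction g -> N g <= 1 ->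
  \int[mu]_z `|h z * g z| <= N' h.
Proof. by move=> mg g1; apply: ereal_sup_ubound; exists g. Qed.

Lemma dual_norm_abs h : N' (abse \o h) = N' h.
Proof.
congr ereal_sup; apply/seteqP; split => _ [g hg <-]; exists g => //;
  by apply: eq_integral => z _; rewrite /= !abseM abse_id.
Qed.

Lemma dual_normZ_le (c : R) h : mfunction h -> (0 <= c)%R ->
  N' (fun z => c%:E * h z) <= c%:E * N' h.
Proof.
move=> mh c0; apply: dual_norm_ler => g mg g1.
under eq_integral do rewrite -muleA abseM gee0_abs ?lee_fin//.
rewrite ge0_integralZl_EFin//; last first.
  by apply: measurableT_comp => //; exact: emeasurable_funM.
by apply: lee_wpmul2l; rewrite ?lee_fin//; exact: integral_le_dual_norm.
Qed.

(** Dividing f by a number slightly larger than N f covers the case N f = 0. *)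
Lemma dual_norm_holder f h : mfunction f -> mfunction h -> N f < +oo -> N' h < +oo ->
  \int[mu]_z `|h z * f z| <= N f * N' h.
Proof.
move=> mf mh; have := fnorm_ge0 hN mf; have := dual_norm_ge0 hN h.
case Ns : (N' h) => [s||//] //; case Nr : (N f) => [r||//] //.
rewrite !lee_fin => s0 r0 _ _; apply/lee_addgt0Pr => e e0.
pose t := (r + e / (s + 1))%R.
have es0 : (0 < e / (s + 1))%R by rewrite divr_gt0// ltr_wpDl.
have t0 : (0 < t)%R by rewrite ltr_wpDl.
have := @integral_le_dual_norm h (fun z => t^-1%:E * f z).
rewrite (fnormZ hN) ?invr_ge0 ?(ltW t0)// Nr Ns.
have r1 : t^-1%:E * r%:E <= 1.
  by rewrite -EFinM lee_fin mulrC ler_pdivrMr// mul1r lerDl ltW.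
move=> /(_ (measurable_funeM _ mf) r1).
under eq_integral do rewrite muleCA abseM gee0_abs ?lee_fin ?invr_ge0 ?(ltW t0)//.
rewrite ge0_integralZl_EFin ?invr_ge0 ?(ltW t0)//; last first.
  by apply: measurableT_comp => //; exact: emeasurable_funM.
rewrite muleC lee_pdivrMr// => /le_trans; apply.
rewrite -!EFinM -EFinD lee_fin /t mulrDr mulrC lerD2l.
by rewrite mulrA ler_pdivrMr ?ltr_wpDl// mulrC ler_pM2l// lerDl.
Qed.

Section rubio_de_francia.
Variable A : (E -> \bar R) -> (E -> \bar R).
Hypothesis A_ge0 : forall f z, 0 <= A f z.
Hypothesis AZ : forall (c : R) f, (0 < c)%R -> mfunction f ->
  A (fun z => c%:E * f z) = (fun z => c%:E * A f z).
Hypothesis A_bounded : exists C : R, forall f, mfunction f -> N' f < +oo ->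
  mfunction (A f) /\ N' (A f) <= C%:E * N' f.

Let opnorm := ereal_sup [set N' (A f) | f in [set f | mfunction f /\ N' f <= 1]].
Let M := fine opnorm.

Let opnorm_ge0 : 0 <= opnorm.
Proof.
apply: (@le_trans _ _ (N' (A (fun=> 0)))); first exact: dual_norm_ge0.
apply: ereal_sup_ubound; exists (fun=> 0) => //; split; first exact: measurable_cst.
apply: dual_norm_ler => g _ _.
by rewrite integral0_eq// => z _; rewrite mul0e abse0.
Qed.

Let opnorm_fin : opnorm \is a fin_num.
Proof.
have [C hC] := A_bounded.
rewrite ge0_fin_numE ?opnorm_ge0//.
apply: (@le_lt_trans _ _ `|C|%:E); last exact: ltry.
apply: ge_ereal_sup => _ [f [mf f1] <-].
have [_ Af] := hC f mf (le_lt_trans f1 (ltry _)).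
apply: (le_trans Af); apply: (@le_trans _ _ (`|C|%:E * N' f)).
  by apply: lee_wpmul2r; [exact: dual_norm_ge0|rewrite lee_fin ler_norm].
by rewrite -[leRHS]mule1; apply: lee_wpmul2l => //; rewrite lee_fin.
Qed.

Let operator_norm_ge0 : (0 <= M)%R.
Proof. exact: fine_ge0 opnorm_ge0. Qed.

(** For N' f > 0 this is homogeneity; for N' f = 0 boundedness of A gives
    N' (A f) = 0 at once. *)
Lemma operator_norm_bound f : mfunction f -> N' f < +oo ->
  mfunction (A f) /\ N' (A f) <= M%:E * N' f.
Proof.
move=> mf foo; have [C hC] := A_bounded.
have [mAf Af] := hC f mf foo; split => //.
have := dual_norm_ge0 hN f; rewrite le_eqVlt => /orP[/eqP N'f0|].
  by move: Af; rewrite -N'f0 !mule0.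
move: foo; case N'f : (N' f) => [s||//] // _; rewrite lte_fin => s0.
pose g z := s^-1%:E * f z.
have mg : mfunction g by exact: measurable_funeM.
have g1 : N' g <= 1.
  apply: le_trans (dual_normZ_le mf _) _; first by rewrite invr_ge0 ltW.
  by rewrite N'f -EFinM mulVf// gt_eqF.
have [mAg _] := hC g mg (le_lt_trans g1 (ltry _)).
have -> : f = (fun z => s%:E * g z).
  by apply/funext => z; rewrite /g muleA -EFinM divff ?mul1e// gt_eqF.
rewrite AZ//; apply: le_trans (dual_normZ_le mAg (ltW s0)) _.
rewrite muleC lee_pmul2r// fineK ?opnorm_fin//.
by apply: ereal_sup_ubound; exists g.
Qed.

Let iterA h k := iter k A (abse \o h).

Lemma iter_operator_ge0 h k z : 0 <= iterA h k z.
Proof. by case: k => [|k]; [exact: abse_ge0|exact: A_ge0]. Qed.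

Lemma iter_operator_bound h k : mfunction h -> N' h < +oo ->
  mfunction (iterA h k) /\ N' (iterA h k) <= (M ^+ k)%:E * N' h.
Proof.
move=> mh hoo; elim: k => [|k [mk ih]].
  rewrite expr0 mul1e /iterA /= dual_norm_abs; split => //.
  exact: measurableT_comp.
have koo : N' (iterA h k) < +oo.
  apply: (le_lt_trans ih); apply: lte_mul_pinfty => //.
  by rewrite lee_fin exprn_ge0// operator_norm_ge0.
have [mA A_le] := operator_norm_bound mk koo.
split => //; apply: (le_trans A_le); rewrite exprS EFinM -muleA.
by apply: lee_wpmul2l => //; rewrite lee_fin operator_norm_ge0.
Qed.

Definition rubio_series h z : \bar R :=
  \sum_(0 <= k <oo) (2 ^+ k * M ^+ k)^-1%:E * iter k A (abse \o h) z.

Let coef k : (0 <= (2 ^+ k * M ^+ k)^-1)%R.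
Proof. by rewrite invr_ge0 mulr_ge0// exprn_ge0// operator_norm_ge0. Qed.

Let term_ge0 h k z : 0 <= (2 ^+ k * M ^+ k)^-1%:E * iterA h k z.
Proof. by rewrite mule_ge0 ?lee_fin ?coef ?iter_operator_ge0. Qed.

Lemma measurable_rubio h : mfunction h -> N' h < +oo -> mfunction (rubio_series h).
Proof.
move=> mh hoo; apply: (ge0_emeasurable_sum (P := xpredT)) => [k z _ _|k _].
  exact: term_ge0.
by apply: measurable_funeM; have [] := iter_operator_bound k mh hoo.
Qed.

Lemma abs_le_rubio h z : `|h z| <= rubio_series h z.
Proof.
rewrite /rubio_series; apply: le_trans (nneseries_lim_ge 1 _); last by move=> k _ _; exact: term_ge0.
by rewrite big_nat1 !expr0 mulr1 invr1 mul1e.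
Qed.

(** The k-th term has dual norm at most 2^-k N' h, and N' is countably
    subadditive because the integral is. *)
Lemma rubio_bound h : mfunction h -> N' h < +oo -> N' (rubio_series h) <= 2%:E * N' h.
Proof.
move=> mh hoo; apply: dual_norm_ler => g mg g1.
pose c k : R := ((2 ^+ k * M ^+ k)^-1)%R.
have mit k : mfunction (iterA h k) by have [] := iter_operator_bound k mh hoo.
have mt k : mfunction (fun z => (c k)%:E * `|iterA h k z * g z|).
  by apply: measurable_funeM; apply: measurableT_comp => //; exact: emeasurable_funM.
have t0 k z : 0 <= (c k)%:E * `|iterA h k z * g z|.
  by rewrite mule_ge0// lee_fin coef.
have mR := measurable_rubio mh hoo.
apply: (@le_trans _ _
    (\int[mu]_z \sum_(0 <= k <oo) (c k)%:E * `|iterA h k z * g z|)).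
  apply: ge0_le_integral => //.
  - by apply: measurableT_comp => //; exact: emeasurable_funM.
  - exact: (ge0_emeasurable_sum (P := xpredT)).
  move=> z _.
  rewrite abseM gee0_abs; last by apply: nneseries_ge0 => k _ _; exact: term_ge0.
  rewrite muleC; apply: le_trans (mule_nneseries_le _ _) _ => //.
    by move=> k; exact: term_ge0.
  apply: lee_nneseries => [k _ _|k _]; first by rewrite mule_ge0 ?term_ge0.
  by rewrite muleCA abseM (gee0_abs (iter_operator_ge0 h k z)) [`|g z| * _]muleC.
rewrite integral_nneseries//.
have N'h0 := dual_norm_ge0 hN h.
move: (hoo) N'h0; case N'h : (N' h) => [s||//] // _; rewrite lee_fin => s0.
apply: le_trans (@epsilon_trick0 R (2 * s) xpredT _); last by rewrite mulr_ge0.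
apply: lee_nneseries => [k _ _|k _]; first by apply: integral_ge0 => z _; exact: t0.
rewrite ge0_integralZl_EFin ?coef//; last first.
  by apply: measurableT_comp => //; exact: emeasurable_funM.
apply: (@le_trans _ _ ((c k)%:E * ((M ^+ k)%:E * s%:E))).
  apply: lee_wpmul2l; first by rewrite lee_fin coef.
  apply: le_trans (integral_le_dual_norm _ mg g1) _.
  by rewrite -N'h; have [] := iter_operator_bound k mh hoo.
rewrite -!EFinM lee_fin expnS natrM natrX /c invfM.
(* if M ^+ k = 0 its inverse is 0 and the product vanishes *)
have M1 : ((M ^+ k)^-1 * M ^+ k <= 1)%R.
  have [->|Mk0] := eqVneq (M ^+ k)%R 0%R; first by rewrite mulr0.
  by rewrite mulVf.
have -> : ((2 ^+ k)^-1 * (M ^+ k)^-1 * (M ^+ k * s) =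
    ((2 ^+ k)^-1 * ((M ^+ k)^-1 * M ^+ k)) * s :> R)%R by ring.
have -> : (2 * s / (2 * 2 ^+ k) = (2 ^+ k)^-1 * s :> R)%R.
  by field; rewrite expf_neq0.
by apply: ler_wpM2r => //; rewrite ler_piMr// invr_ge0 exprn_ge0.
Qed.

Variable B : nat -> set E.
Hypothesis mB : forall k, measurable (B k).
Hypothesis B_fin : forall k, mu (B k) < +oo.
Hypothesis B_nd : forall k, B k `<=` B k.+1.
Hypothesis B_near : forall z, \forall k \near \oo, B k z.

(** For h >= 0 in the dual space the weight w = rubio_series h majorizes h and
    lies in the dual space, with norm at most 2 N' h. So
    int G h <= int G w <= C int F w <= C N(F) N'(w) <= 2 C N(F) N'(h),
    and the Lorentz-Luxemburg theorem turns this into a bound for N(G). *)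
Lemma rubio_de_francia_extrapolation (F G : E -> \bar R) (C : R) :
  (0 <= C)%R -> mfunction F -> mfunction G ->
  (forall z, 0 <= F z) -> (forall z, 0 <= G z) -> N F < +oo ->
  (forall h, mfunction h -> N' h < +oo ->
    \int[mu]_z (G z * rubio_series h z) <= C%:E * \int[mu]_z (F z * rubio_series h z)) ->
  N G <= (2 * C)%:E * N F.
Proof.
move=> C0 mF mG F0 G0; have := fnorm_ge0 hN mF.
case NF : (N F) => [r||//] // + _ hw; rewrite lee_fin -EFinM => r0.
apply: (lorentz_luxemburg hN mB B_fin B_nd B_near) => //; first by rewrite !mulr_ge0.
move=> h mh h0 hoo.
have mh' : mfunction (EFin \o h) by exact/measurable_EFinP.
have mR := measurable_rubio mh' hoo.
have R0 z : 0 <= rubio_series (EFin \o h) z by apply: le_trans (abs_le_rubio _ _).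
apply: (@le_trans _ _ (\int[mu]_z (G z * rubio_series (EFin \o h) z))).
  apply: ge0_le_integral => //.
  - by move=> z _; rewrite mule_ge0// lee_fin.
  - exact: emeasurable_funM.
  - exact: emeasurable_funM.
  - move=> z _; apply: lee_wpmul2l => //.
    by apply: le_trans (abs_le_rubio _ _); rewrite /= ger0_norm.
apply: (le_trans (hw _ mh' hoo)).
rewrite [(2 * C)%R]mulrC -!mulrA EFinM -muleA.
apply: lee_wpmul2l; first by rewrite lee_fin.
have Rb := rubio_bound mh' hoo.
have Roo : N' (rubio_series (EFin \o h)) < +oo.
  by apply: (le_lt_trans Rb); apply: lte_mul_pinfty.
have Foo : N F < +oo by rewrite NF ltry.
have -> : \int[mu]_z (F z * rubio_series (EFin \o h) z) =
    \int[mu]_z `|rubio_series (EFin \o h) z * F z|.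
  by apply: eq_integral => z _; rewrite gee0_abs ?mule_ge0// muleC.
apply: (le_trans (dual_norm_holder mF mR Foo Roo)).
rewrite NF mulrC EFinM -muleA; apply: lee_wpmul2l => //; by rewrite lee_fin.
Qed.

End rubio_de_francia.
End extrapolation.

(** * Ball Banach function spaces on R^n x R^m *)

Section product_space.
Context (R : realType) (n m : nat).
Local Notation E := (Rnm R n m).
Local Notation mu := (@lebesgue_Rnm R n m).
Implicit Types (N : (E -> \bar R) -> \bar R) (f : E -> \bar R).

Lemma ball_banach_function_norm N : product_ball_banach N -> function_norm mu N.
Proof.
move=> hN; have hq := pbb_quasi_banach hN; have qn := pbqb_quasi_norm hq.
split.
- exact: (quasi_norm_ge0 qn).
- by move=> c f mf c0; rewrite (quasi_normZ qn)// ger0_norm.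
- exact: (pbb_triangle hN).
- exact: (pbqb_le hq).
- by move=> u f mu_ mf uf; have [] := pbqb_fatou hq mu_ mf uf.
Qed.

(** Measurability of balls is part of the assertion that their indicators
    belong to the space. *)
Lemma measurable_eball N (z : E) (r : R) : product_ball_banach N -> (0 < r)%R ->
  measurable (eball z r).
Proof.
move=> hN r0; have [+ _] := pbqb_ball (pbb_quasi_banach hN) z r0.
move/measurable_EFinP => /(_ measurableT [set 1%R] (measurable_set1 _)).
rewrite setTI (_ : _ @^-1` _ = eball z r)//.
apply/seteqP; split => u /=; rewrite indicE.
  by case: (boolP (u \in eball z r)) => [/set_mem//|_] /esym/eqP; rewrite oner_eq0.
by move=> zu; rewrite mem_set.
Qed.

(** Local integrability, applied to the indicator of the ball itself. *)
Lemma eball_finite N (z : E) (r : R) : product_ball_banach N -> (0 < r)%R ->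
  mu (eball z r) < +oo.
Proof.
move=> hN r0; have [C C0 hC] := pbb_integral hN z r0.
have cB := pbqb_ball (pbb_quasi_banach hN) z r0.
have := hC _ cB.
under eq_integral.
  move=> u uB; rewrite indicE uB /= normr1; over.
rewrite integral_cst; last exact: (measurable_eball z hN).
rewrite mul1e => /le_lt_trans; apply.
case: cB => mB Boo.
by apply: lte_mul_pinfty => //; rewrite lee_fin ltW.
Qed.

Definition origin : E := ([tuple 0%R | _ < n], [tuple 0%R | _ < m]).

Lemma near_eball (z : E) : \forall k \near \oo, eball origin k.+1%:R z.
Proof.
near=> k; rewrite /eball /=; apply: (@lt_trans _ _ k%:R); last by rewrite ltr_nat.
near: k; exact: nbhs_infty_gtr.
Unshelve. all: by end_near.
Qed.

Lemma measurable_rectangle (A : set E) : rectangle A -> measurable A.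
Proof.
move=> [a [l [b [l' [_ _ ->]]]]].
apply: sub_caratheodory; apply: sub_sigma_algebra.
by apply: measurableX; exact: measurable_cube.
Qed.

Lemma exists_rectangle (z : E) : exists2 A : set E, rectangle A & A z.
Proof.
exists (cube z.1 1 `*` cube z.2 1); first by exists z.1, 1%R, z.2, 1%R.
by split => i; rewrite lexx lerDl ler01.
Qed.

(** The supremum of the empty set would be -oo: a rectangle through z has to be
    exhibited. *)
Lemma strong_maximal_ge0 f z : 0 <= strong_maximal f z.
Proof.
have [A rA Az] := exists_rectangle z.
apply: (@le_trans _ _ ((mu A)^-1 * \int[mu]_(u in A) `|f u|)).
  by rewrite mule_ge0 ?inve_ge0 ?measure_ge0// integral_ge0.
by apply: ereal_sup_ubound; exists A.
Qed.

Lemma strong_maximalZ (c : R) f : (0 < c)%R -> mfunction f ->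
  strong_maximal (fun z => c%:E * f z) = (fun z => c%:E * strong_maximal f z).
Proof.
move=> c0 mf; apply/funext => z; rewrite /strong_maximal.
have [A0 rA0 A0z] := exists_rectangle z.
rewrite -ereal_supZl ?(ltW c0)//; last first.
  by apply/set0P; exists ((mu A0)^-1 * \int[mu]_(u in A0) `|f u|), A0.
congr ereal_sup; rewrite image_comp; apply: eq_imagel => A [rA _] /=.
under eq_integral do rewrite abseM gee0_abs ?lee_fin ?(ltW c0)//.
rewrite ge0_integralZl_EFin ?(ltW c0)//; first by rewrite muleCA.
  exact: measurable_rectangle.
by apply: measurable_funTS; apply: measurableT_comp.
Qed.

End product_space.

Lemma power_norm_poweR (R : realType) (n m : nat) (X : (Rnm R n m -> \bar R) -> \bar R)
    (q : R) (f : Rnm R n m -> \bar R) : (0 < q)%R -> (forall z, 0 <= f z) ->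
  power_norm X q^-1 (fun z => f z `^ q) = X f `^ q.
Proof.
move=> q0 f0; rewrite /power_norm invrK; congr (X _ `^ q); apply/funext => z.
by rewrite gee0_abs ?poweR_ge0// -poweRrM divff ?poweRe1// gt_eqF.
Qed.

Theorem theorem6p1 (R : realType) (n m : nat) (hn : (0 < n)%N) (hm : (0 < m)%N)
    (q0 : R) (hq0 : (0 < q0)%R)
    (X : (Rnm R n m -> \bar R) -> \bar R)
    (hX : product_ball_quasi_banach X)
    (hY : product_ball_banach (power_norm X q0^-1))
    (hM : bounded_operator (associate_norm (power_norm X q0^-1))
            (@strong_maximal R n m))
    (T : (Rnm R n m -> \bar R) -> (Rnm R n m -> \bar R))
    (F : set ((Rnm R n m -> \bar R) * (Rnm R n m -> \bar R)))
    (hF : forall g f, F (g, f) ->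
      [/\ g = T f,
          mfunction g /\ (forall z, 0 <= g z) &
          mfunction f /\ (forall z, 0 <= f z)])
    (C0 : R)
    (hw : forall w0 : Rnm R n m -> \bar R,
      [set rubio_de_francia (associate_norm (power_norm X q0^-1)) h
        | h in carrier (associate_norm (power_norm X q0^-1))] w0 ->
      forall g f, F (g, f) ->
        \int[lebesgue_Rnm]_z (g z `^ q0 * w0 z) <=
          C0%:E * \int[lebesgue_Rnm]_z (f z `^ q0 * w0 z)) :
  exists2 C : R, (0 < C)%R &
    forall g f, F (g, f) -> carrier X f -> X g <= C%:E * X f.
Proof.
pose N := power_norm X q0^-1.
have hN : function_norm (@lebesgue_Rnm R n m) N by exact: ball_banach_function_norm.
pose C1 := Num.max C0 1%R.
have C1_gt0 : (0 < C1)%R by rewrite lt_max ltr01 orbT.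
pose B k : set (Rnm R n m) := eball (origin R n m) k.+1%:R.
have Bm k : measurable (B k) by exact: measurable_eball hY _.
have Bfin k : lebesgue_Rnm (B k) < +oo by exact: eball_finite hY _.
have Bnd k : B k `<=` B k.+1 by move=> z /lt_trans; apply; rewrite ltr_nat.
have Bnear z : \forall k \near \oo, B k z by exact: near_eball.
have A_bounded : exists C : R, forall f, measurable_fun setT f ->
    dual_norm lebesgue_Rnm N f < +oo ->
    measurable_fun setT (strong_maximal f) /\
    dual_norm lebesgue_Rnm N (strong_maximal f) <= C%:E * dual_norm lebesgue_Rnm N f.
  have [C hC] := hM; exists C => f mf foo.
  by have [[]] := hC f (conj mf foo).
exists ((2 * C1) `^ q0^-1)%R; first by rewrite powR_gt0// mulr_gt0.
move=> g f Fgf [mf foo]; have [_ [mg g0] [_ f0]] := hF _ _ Fgf.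
have mp (u : Rnm R n m -> \bar R) : mfunction u -> mfunction (fun z => u z `^ q0).
  by move=> mu; exact: (measurableT_comp (measurable_poweR q0) mu).
have Nf : N (fun z => f z `^ q0) < +oo.
  by rewrite /N power_norm_poweR// poweR_lty.
have main : N (fun z => g z `^ q0) <= (2 * C1)%:E * N (fun z => f z `^ q0).
  apply: (@rubio_de_francia_extrapolation _ _ _ _ N hN (@strong_maximal R n m)
    (@strong_maximal_ge0 R n m) (@strong_maximalZ R n m) A_bounded B Bm Bfin Bnd Bnear
    _ _ C1 (ltW C1_gt0) (mp f mf) (mp g mg) _ _ Nf).
  - by move=> z; exact: poweR_ge0.
  - by move=> z; exact: poweR_ge0.
  move=> h mh hoo.
  have wh : [set rubio_de_francia (associate_norm (power_norm X q0^-1)) h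
        | h in carrier (associate_norm (power_norm X q0^-1))]
        (rubio_series lebesgue_Rnm N (@strong_maximal R n m) h) by exists h.
  apply: (le_trans (hw _ wh g f Fgf)).
  apply: lee_wpmul2r; last by rewrite lee_fin le_max lexx.
  apply: integral_ge0 => z _; rewrite mule_ge0 ?poweR_ge0//.
  exact: le_trans (abse_ge0 (h z))
    (abs_le_rubio hN (@strong_maximal_ge0 R n m) h z).
have X_ge0 u : mfunction u -> 0 <= X u := @quasi_norm_ge0 _ _ _ _ (pbqb_quasi_norm hX) u.
move: main; rewrite /N !power_norm_poweR// => main.
have root u : mfunction u -> X u = (X u `^ q0) `^ q0^-1.
  by move=> mu; rewrite -poweRrM divff ?gt_eqF// poweRe1// X_ge0.
have C0_ge0 : 0 <= (2 * C1)%:E by rewrite lee_fin mulr_ge0// ltW.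
rewrite (root _ mg) (root _ mf) -poweR_EFin -poweRM ?poweR_ge0//.
apply: gt0_ler_poweR main; rewrite ?invr_ge0 ?(ltW hq0)//.
  by rewrite in_itv /= poweR_ge0 leey.
by rewrite in_itv /= leey mule_ge0 ?poweR_ge0.
Qed.
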